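(* Let $a,k,\gamma,h_0,u_\infty,u_0>0$ and $\lambda\ge0$ be constants, let $\beta,\delta$ be real constants with $\beta\ge\delta$ and $\beta+\delta+1>0$, and put $\alpha=\beta-\delta$. Consider the common system $$\frac{\partial u}{\partial t}=a^2\frac{\partial^2u}{\partial x^2}\ (0<x<s(t),\ t>0),\quad u(s(t),t)=0,\quad -k\frac{\partial u}{\partial x}(s(t),t)=\gamma s^{\beta}(t)\dot s^{\delta}(t)\dot s(t)\ (t>0),\quad s(0)=0. \quad( * )$$ Let $(P)$ be the problem $( * )$ together with $k\frac{\partial u}{\partial x}(0,t)=\frac{h_0}{\sqrt t}\left[\lambda u(0,t)-u_\infty t^{\alpha/2}\right]$, $t>0$, and let $(P_D)$ be the problem $( * )$ together with $u(0,t)=u_0t^{\alpha/2}$, $t>0$. Let $\xi$ be the unique positive solution of $$\frac{ku_\infty}{\gamma2^{\beta+1}a^{\beta+\delta+2}}\cdot\frac{1}{\frac{k}{2ah_0}M(\frac{\alpha}{2}+\frac12,\frac12,z^2)+\lambda zM(\frac{\alpha}{2}+1,\frac32,z^2)}=z^{\beta+\delta+1},\quad z>0.$$ If the parameters are related by $$u_0=\frac{u_\infty\,\xi M(-\frac{\alpha}{2}+\frac12,\frac32,-\xi^2)}{\frac{k}{2ah_0}M(-\frac{\alpha}{2},\frac12,-\xi^2)+\lambda\xi M(-\frac{\alpha}{2}+\frac12,\frac32,-\xi^2)},$$ then $(P)$ and $(P_D)$ are equivalent, i.e. they have the same similarity type solution $(u,s)$; moreover $\xi$ coincides with the unique positive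 solution $\xi_D$ of $$\frac{ku_0}{\gamma2^{\beta+1}a^{\beta+\delta+2}}\cdot\frac{1}{zM(\frac{\alpha}{2}+1,\frac32,z^2)}=z^{\beta+\delta+1},\quad z>0.$$
   Context: $M$ is Kummer's confluent hypergeometric function of the first kind, $M(p,q,z)=\sum_{n=0}^{\infty}\frac{(p)_n}{(q)_n}\frac{z^n}{n!}$, with $(p)_0=1$, $(p)_n=p(p+1)\cdots(p+n-1)$. The dot denotes $d/dt$; the unknowns are $u(x,t)$, $0\le x\le s(t)$, $t>0$, and $s(t)$. A solution $(u,s)$ is of similarity type if $u(x,t)=t^{\alpha/2}\varphi(\eta)$, $\eta=\frac{x}{2a\sqrt t}$, with $\varphi$ twice continuously differentiable on $[0,\xi]$, and $s(t)=2\xi a\sqrt t$ for a constant $\xi>0$. Under the stated hypotheses each of the two problems has a unique similarity type solution, of the form $$u=t^{\alpha/2}\left[C_1M\left(-\tfrac{\alpha}{2},\tfrac12,-\eta^2\right)+C_2\eta M\left(-\tfrac{\alpha}{2}+\tfrac12,\tfrac32,-\eta^2\right)\right],\qquad s(t)=2\xi a\sqrt t.$$ For $(P)$: $\xi$ is the solution of the first equation of the claim and, with $D=\frac{k}{2ah_0}M(-\frac{\alpha}{2},\frac12,-\xi^2)+\lambda\xi M(-\frac{\alpha}{2}+\frac12,\frac32,-\xi^2)$, $C_1=u_\infty\xi M(-\frac{\alpha}{2}+\frac12,\frac32,-\xi^2)/D$ and $C_2=-u_\infty M(-\frac{\alpha}{2},\frac12,-\xi^2)/D$. For $(P_D)$: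 $\xi$ is replaced by $\xi_D$ and $C_1$, $C_2$ are replaced by $C_{1D}=u_0$, $C_{2D}=-\dfrac{u_0M(-\frac{\alpha}{2},\frac12,-\xi_D^2)}{\xi_DM(-\frac{\alpha}{2}+\frac12,\frac32,-\xi_D^2)}$. *)

(* Defs.v *)
From Stdlib Require Import Reals Factorial.
From Coquelicot Require Import Coquelicot.
Open Scope R_scope.

Fixpoint poch (p : R) (n : nat) : R :=
  match n with
  | O => 1
  | S m => poch p m * (p + INR m)
  end.

(* Only used with q = 1/2 and q = 3/2, so that no denominator vanishes and the
   series converges for every z. *)
Definition kummerM (p q z : R) : R :=
  PSeries (fun n => poch p n / poch q n / INR (fact n)) z.

Definition segment (c d y : R) : Prop := c <= y <= d.

(* Derivative relative to a set: the usual derivative at interior points of D,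
   the one-sided derivative at an endpoint of an interval D. *)
Definition is_derive_within (D : R -> Prop) (f : R -> R) (x l : R) : Prop :=
  filterlim (fun y => (f y - f x) / (y - x)) (within D (locally' x)) (locally l).

Definition C2_on (D : R -> Prop) (f : R -> R) : Prop :=
  exists f1 f2 : R -> R,
    (forall x, D x -> is_derive_within D f x (f1 x)) /\
    (forall x, D x -> is_derive_within D f1 x (f2 x)) /\
    continuous_on D f2.

Section Problems.

Variables a k gamma h0 uinf u0 lambda beta delta alpha : R.

Definition heat_equation (u : R -> R -> R) (s : R -> R) : Prop :=
  forall x t, 0 < t -> 0 < x < s t ->
    ex_derive (fun tau => u x tau) t /\
    locally x (fun y => ex_derive (fun z => u z t) y) /\
    ex_derive_n (fun y => u y t) 2 x /\
    Derive (fun tau => u x tau) t = a ^ 2 * Derive_n (fun y => u y t) 2 x.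

(* Rpower is the real power for a positive base only; the bases s(t) and s'(t)
   are positive for every pair (u, s) of similarity type. *)
Definition stefan_condition (u : R -> R -> R) (s : R -> R) : Prop :=
  forall t, 0 < t ->
    exists ux ds : R,
      is_derive_within (segment 0 (s t)) (fun y => u y t) (s t) ux /\
      is_derive s t ds /\
      - k * ux = gamma * Rpower (s t) beta * Rpower ds delta * ds.

Definition common_system (u : R -> R -> R) (s : R -> R) : Prop :=
  heat_equation u s /\
  (forall t, 0 < t -> u (s t) t = 0) /\
  stefan_condition u s /\
  s 0 = 0.

Definition convective_condition (u : R -> R -> R) (s : R -> R) : Prop :=
  forall t, 0 < t ->
    exists ux : R,
      is_derive_within (segment 0 (s t)) (fun y => u y t) 0 ux /\
      k * ux = h0 / sqrt t * (lambda * u 0 t - uinf * Rpower t (alpha / 2)).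

Definition dirichlet_condition (u : R -> R -> R) : Prop :=
  forall t, 0 < t -> u 0 t = u0 * Rpower t (alpha / 2).

Definition problem_P (u : R -> R -> R) (s : R -> R) : Prop :=
  common_system u s /\ convective_condition u s.

Definition problem_PD (u : R -> R -> R) (s : R -> R) : Prop :=
  common_system u s /\ dirichlet_condition u.

Definition similarity_type (xi : R) (u : R -> R -> R) (s : R -> R) : Prop :=
  0 < xi /\
  (forall t, 0 < t -> s t = 2 * xi * a * sqrt t) /\
  exists phi : R -> R,
    C2_on (segment 0 xi) phi /\
    forall x t, 0 < t -> 0 <= x <= s t ->
      u x t = Rpower t (alpha / 2) * phi (x / (2 * a * sqrt t)).

(* The values of u outside 0 <= x <= s(t), t > 0, and those of s at negative
   times have no meaning for the problems. *)
Definition same_pair (u u' : R -> R -> R) (s s' : R -> R) : Prop :=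
  (forall t, 0 <= t -> s' t = s t) /\
  (forall x t, 0 < t -> 0 <= x <= s t -> u' x t = u x t).

(* The coefficient xi' of a competing pair (u', s') is not prescribed. *)
Definition unique_similarity_solution
    (problem : (R -> R -> R) -> (R -> R) -> Prop)
    (xi : R) (u : R -> R -> R) (s : R -> R) : Prop :=
  similarity_type xi u s /\ problem u s /\
  forall xi' u' s',
    similarity_type xi' u' s' -> problem u' s' -> same_pair u u' s s'.

Definition coefficient_P (z : R) : Prop :=
  0 < z /\
  k * uinf / (gamma * Rpower 2 (beta + 1) * Rpower a (beta + delta + 2)) *
    (1 / (k / (2 * a * h0) * kummerM (alpha / 2 + 1 / 2) (1 / 2) (z ^ 2)
          + lambda * z * kummerM (alpha / 2 + 1) (3 / 2) (z ^ 2)))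
  = Rpower z (beta + delta + 1).

Definition coefficient_PD (z : R) : Prop :=
  0 < z /\
  k * u0 / (gamma * Rpower 2 (beta + 1) * Rpower a (beta + delta + 2)) *
    (1 / (z * kummerM (alpha / 2 + 1) (3 / 2) (z ^ 2)))
  = Rpower z (beta + delta + 1).

End Problems.

(* Main.v *)
Require Import Defs.
From Stdlib Require Import Reals Lra Lia Factorial.
From Coquelicot Require Import Coquelicot.
Open Scope R_scope.

(** Substituting [u = t^(alpha/2) phi(eta)] in the heat equation gives
    [phi'' + 2 eta phi' - 2 alpha phi = 0] on [(0, xi)]. A basis of solutions is
    [e^(-eta^2) A] and [e^(-eta^2) B] with [A = M(alpha/2+1/2, 1/2, eta^2)] and
    [B = eta M(alpha/2+1, 3/2, eta^2)], whose Wronskian is [e^(-eta^2)]. Hence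
    [phi = e^(-eta^2) (c1 A + c2 B)], the condition [phi(xi) = 0] gives
    [phi'(xi) = - c1 / B(xi)], and the Stefan condition becomes
    [k c1 = B(xi) N xi^p] with [N = gamma 2^(beta+1) a^(beta+delta+2)] and
    [p = beta + delta + 1]. The Dirichlet condition says [c1 = u0], the convective
    one, with [kap = k / (2 a h0)], says [kap c2 = lambda c1 - uinf], that is
    [c1 (kap A + lambda B)(xi) = uinf B(xi)]. By Kummer's transformation the
    relation between the parameters is [u0 (kap A + lambda B)(xi) = uinf B(xi)], so
    that both problems select the same [c1], [c2] and [xi]. Uniqueness of [xi] holds
    because [z^p (kap A + lambda B)] is strictly increasing. *)

(** * Kummer series *)

Definition kummer_coef (p q : R) (n : nat) : R :=
  poch p n / poch q n / INR (fact n).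

Lemma poch_pos p n : 0 < p -> 0 < poch p n.
Proof.
  intros hp; induction n as [|n IH]; simpl; [lra|].
  pose proof (pos_INR n); apply Rmult_lt_0_compat; lra.
Qed.

Lemma kummer_coef_S p q n : 0 < q ->
  kummer_coef p q (S n)
  = kummer_coef p q n * ((p + INR n) / ((q + INR n) * INR (S n))).
Proof.
  intros hq; unfold kummer_coef.
  assert (H1 := poch_pos q n hq).
  assert (H2 := INR_fact_lt_0 n).
  assert (H3 := lt_0_INR (S n) ltac:(lia)).
  assert (H4 := pos_INR n).
  rewrite fact_simpl, mult_INR; cbn [poch].
  field; repeat split; lra.
Qed.

(** Consecutive coefficients have a ratio of modulus at most [L / (n + 1)], because
    [|p + n| <= |p| + n <= L (q + n)] for [L = 1 + |p| / q]. The sign of [p] is free, as the series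
    with [p = - alpha / 2] require. *)
Lemma kummer_coef_bound p q : 0 < q ->
  exists L, 1 <= L /\ forall n, Rabs (kummer_coef p q n) <= L ^ n / INR (fact n).
Proof.
  intros hq; exists (1 + Rabs p / q).
  assert (HL : 0 <= Rabs p / q)
    by (apply Rmult_le_pos; [apply Rabs_pos | left; apply Rinv_0_lt_compat, hq]).
  split; [lra|].
  intros n; induction n as [|n IH].
  - unfold kummer_coef; simpl. rewrite Rabs_pos_eq; lra.
  - rewrite kummer_coef_S, Rabs_mult by assumption.
    assert (H3 := lt_0_INR (S n) ltac:(lia)).
    assert (H4 := pos_INR n).
    assert (H2 := INR_fact_lt_0 n).
    replace ((1 + Rabs p / q) ^ S n / INR (fact (S n))) with
      ((1 + Rabs p / q) ^ n / INR (fact n) * ((1 + Rabs p / q) / INR (S n))).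
    2:{ rewrite fact_simpl, mult_INR; cbn [pow]; field; repeat split; lra. }
    apply Rmult_le_compat; try apply Rabs_pos; [exact IH|].
    assert (Hqn : 0 < q + INR n) by lra.
    rewrite Rabs_div, (Rabs_pos_eq (_ * _))
      by (try apply Rgt_not_eq; nra).
    replace (Rabs (p + INR n) / ((q + INR n) * INR (S n)))
      with (Rabs (p + INR n) / (q + INR n) / INR (S n)) by (field; lra).
    apply Rmult_le_compat_r; [left; apply Rinv_0_lt_compat, H3|].
    apply Rle_div_l; [exact Hqn|].
    apply Rle_trans with (Rabs p + INR n).
    + eapply Rle_trans; [apply Rabs_triang|].
      rewrite (Rabs_pos_eq (INR n)); lra.
    + replace ((1 + Rabs p / q) * (q + INR n))
        with (Rabs p + INR n + (q + Rabs p / q * INR n)) by (field; lra).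
      assert (0 <= Rabs p / q * INR n) by (apply Rmult_le_pos; lra); lra.
Qed.

Lemma pow_div_fact_le_exp x n : 0 <= x -> x ^ n / INR (fact n) <= exp x.
Proof.
  intros hx; eapply Rle_trans; [|apply (exp_ge_taylor x n hx)].
  assert (Hp : forall m, 0 <= x ^ m / INR (fact m)).
  { intros m; apply Rmult_le_pos; [apply pow_le, hx|].
    left; apply Rinv_0_lt_compat, INR_fact_lt_0. }
  destruct n as [|n]; [simpl; lra | rewrite tech5].
  assert (H := cond_pos_sum (fun k => x ^ k / INR (fact k)) n Hp); lra.
Qed.

(** For each [r >= 0] the terms [|c n| r ^ n] are at most [(L r) ^ n / n!], hence bounded by
    [exp (L r)], so no finite radius is possible. *)
Lemma CV_radius_kummer p q : 0 < q -> CV_radius (kummer_coef p q) = p_infty.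
Proof.
  intros hq.
  destruct (kummer_coef_bound p q hq) as (L & HL & Hb).
  destruct (CV_radius_bounded (kummer_coef p q)) as [Hub _].
  assert (Hall : forall r, 0 <= r -> Rbar_le r (CV_radius (kummer_coef p q))).
  { intros r hr; apply Hub; exists (exp (L * r)); intros n.
    rewrite Rabs_mult, (Rabs_pos_eq (r ^ n)) by (apply pow_le, hr).
    eapply Rle_trans; [|apply (pow_div_fact_le_exp _ n); nra].
    rewrite Rpow_mult_distr.
    replace (L ^ n * r ^ n / INR (fact n)) with (L ^ n / INR (fact n) * r ^ n)
      by (field; apply INR_fact_neq_0).
    apply Rmult_le_compat_r; [apply pow_le, hr | apply Hb]. }
  destruct (CV_radius (kummer_coef p q)) as [r| |]; [|reflexivity|].
  - assert (H := Hall (Rabs r + 1) ltac:(pose proof (Rabs_pos r); lra)).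
    simpl in H; pose proof (Rle_abs r); lra.
  - exact (False_ind _ (Hall 0 (Rle_refl 0))).
Qed.

Lemma is_derive_kummerM p q z : 0 < q ->
  is_derive (kummerM p q) z (PSeries (PS_derive (kummer_coef p q)) z).
Proof.
  intros hq; apply is_derive_PSeries.
  change (Rbar_lt (Rabs z) (CV_radius (kummer_coef p q))).
  rewrite CV_radius_kummer by assumption; exact I.
Qed.

Lemma Derive_kummerM p q z : 0 < q ->
  Derive (kummerM p q) z = PSeries (PS_derive (kummer_coef p q)) z.
Proof. intros hq; apply is_derive_unique, is_derive_kummerM, hq. Qed.

Lemma is_derive2_kummerM p q z : 0 < q ->
  is_derive (Derive (kummerM p q)) z
    (PSeries (PS_derive (PS_derive (kummer_coef p q))) z).
Proof.
  intros hq.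
  apply is_derive_ext with (PSeries (PS_derive (kummer_coef p q))).
  { intros t; symmetry; apply Derive_kummerM, hq. }
  apply is_derive_PSeries.
  rewrite CV_radius_derive, CV_radius_kummer by assumption; exact I.
Qed.

(** Kummer's differential equation. Coefficient by coefficient it is the recurrence
    [(n + 1) (q + n) c (n + 1) = (p + n) c n]. *)
Lemma kummer_equation p q z : 0 < q ->
  z * Derive (Derive (kummerM p q)) z + (q - z) * Derive (kummerM p q) z
  = p * kummerM p q z.
Proof.
  intros hq.
  rewrite (is_derive_unique _ _ _ (is_derive2_kummerM p q z hq)).
  rewrite Derive_kummerM by assumption.
  set (c := kummer_coef p q).
  assert (R0 : CV_radius c = p_infty) by (apply CV_radius_kummer, hq).
  assert (Hex : forall b, CV_radius b = p_infty -> ex_pseries b z).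
  { intros b Hb; apply CV_radius_inside; rewrite Hb; exact I. }
  assert (R1 : CV_radius (PS_derive c) = p_infty) by (rewrite CV_radius_derive; exact R0).
  assert (R2 : CV_radius (PS_derive (PS_derive c)) = p_infty)
    by (rewrite CV_radius_derive; exact R1).
  assert (E1 : z * PSeries (PS_derive (PS_derive c)) z + q * PSeries (PS_derive c) z
     = PSeries (PS_plus (PS_incr_1 (PS_derive (PS_derive c)))
                        (PS_scal q (PS_derive c))) z).
  { rewrite PSeries_plus, PSeries_incr_1, PSeries_scal; [reflexivity | |].
    - apply Hex; rewrite CV_radius_incr_1; exact R2.
    - apply ex_pseries_scal; [apply Rmult_comm | apply Hex, R1]. }
  assert (E2 : z * PSeries (PS_derive c) z + p * PSeries c z
     = PSeries (PS_plus (PS_incr_1 (PS_derive c)) (PS_scal p c)) z).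
  { rewrite PSeries_plus, PSeries_incr_1, PSeries_scal; [reflexivity | |].
    - apply Hex; rewrite CV_radius_incr_1; exact R1.
    - apply ex_pseries_scal; [apply Rmult_comm | apply Hex, R0]. }
  assert (E3 : PSeries (PS_plus (PS_incr_1 (PS_derive (PS_derive c)))
                        (PS_scal q (PS_derive c))) z
     = PSeries (PS_plus (PS_incr_1 (PS_derive c)) (PS_scal p c)) z).
  { apply PSeries_ext; intros n; unfold PS_plus, PS_scal, PS_incr_1, PS_derive.
    assert (Hc := kummer_coef_S p q n hq).
    assert (H3 := lt_0_INR (S n) ltac:(lia)).
    assert (H4 := pos_INR n).
    assert (Hc' : INR (S n) * c (S n) * (q + INR n) = (p + INR n) * c n)
      by (unfold c; rewrite Hc; field; lra).
    change (match n with O => 0 | S m => INR (S m) * (INR (S (S m)) * c (S (S m))) end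
            + q * (INR (S n) * c (S n))
            = match n with O => 0 | S m => INR (S m) * c (S m) end + p * c n).
    (* The shift [PS_incr_1] puts 0 at index 0, so the constant term is compared separately. *)
    destruct n as [|n]; [simpl INR in *; lra|].
    rewrite (S_INR (S n)) in *; lra. }
  change (kummerM p q z) with (PSeries c z).
  lra.
Qed.

Lemma kummerM_0 p q : kummerM p q 0 = 1.
Proof.
  unfold kummerM; rewrite PSeries_0; simpl; field.
Qed.

Lemma kummer_coef_nonneg p q n : 0 < p -> 0 < q -> 0 <= kummer_coef p q n.
Proof.
  intros hp hq; unfold kummer_coef, Rdiv.
  repeat apply Rmult_le_pos; left;
    [apply poch_pos, hp | apply Rinv_0_lt_compat, poch_pos, hq
    | apply Rinv_0_lt_compat, INR_fact_lt_0].
Qed.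

(** For positive parameters all coefficients are nonnegative, so the series can be compared term by
    term. *)
Lemma kummerM_increasing p q x y : 0 < p -> 0 < q -> 0 <= x <= y ->
  kummerM p q x <= kummerM p q y.
Proof.
  intros hp hq hxy; unfold kummerM, PSeries; apply Series_le.
  - intros n; change (0 <= kummer_coef p q n * x ^ n <= kummer_coef p q n * y ^ n).
    assert (H := kummer_coef_nonneg p q n hp hq).
    split; [apply Rmult_le_pos; [exact H | apply pow_le; lra]|].
    apply Rmult_le_compat_l; [exact H | apply pow_incr; lra].
  - apply ex_pseries_R, CV_radius_inside.
    change (Rbar_lt (Rabs y) (CV_radius (kummer_coef p q))).
    rewrite CV_radius_kummer by assumption; exact I.
Qed.

Lemma kummerM_ge_1 p q x : 0 < p -> 0 < q -> 0 <= x -> 1 <= kummerM p q x.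
Proof.
  intros hp hq hx; rewrite <- (kummerM_0 p q); apply kummerM_increasing; lra.
Qed.

(** * The similarity equation *)

(** The equation [f'' = b x f' + c f] at one point, written as a first-order system whose second
    component is an explicit [f1]. The similarity equation is the case [b = -2], [c = 2 alpha]. *)
Definition lin_sol (b c : R) (f f1 : R -> R) (x : R) : Prop :=
  is_derive f x (f1 x) /\ is_derive f1 x (b * x * f1 x + c * f x).

Lemma lin_sol_ext b c f f1 g g1 x :
  (forall y, f y = g y) -> (forall y, f1 y = g1 y) ->
  lin_sol b c f f1 x -> lin_sol b c g g1 x.
Proof.
  intros H H1 [K K1]; split.
  - apply is_derive_ext with f; [exact H|]. rewrite <- H1; exact K.
  - apply is_derive_ext with f1; [exact H1|]. rewrite <- H1, <- H; exact K1.
Qed.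

(** Kummer's equation with [q = 1/2] under the substitution [z = sg y^2]. Both signs occur: [sg = 1]
    gives [even_part], and [sg = -1] gives the series of Kummer's transformation. *)
Lemma kummer_even_sol p sg x :
  lin_sol (2 * sg) (4 * sg * p)
    (fun y => kummerM p (1 / 2) (sg * y ^ 2))
    (fun y => 2 * sg * y * Derive (kummerM p (1 / 2)) (sg * y ^ 2)) x.
Proof.
  assert (H1 := fun z => ex_intro _ _ (is_derive_kummerM p (1 / 2) z ltac:(lra))
                 : ex_derive (kummerM p (1 / 2)) z).
  assert (H2 := fun z => ex_intro _ _ (is_derive2_kummerM p (1 / 2) z ltac:(lra))
                 : ex_derive (Derive (kummerM p (1 / 2))) z).
  assert (H3 := kummer_equation p (1 / 2) (sg * x ^ 2) ltac:(lra)).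
  revert H1 H2 H3; generalize (kummerM p (1 / 2)); intros m H1 H2 H3.
  split.
  - auto_derive; [apply H1 | ].
    change (fun x0 : R => m x0) with m; simpl; ring.
  - revert H2 H3; generalize (Derive m); intros m1 H2 H3.
    auto_derive; [apply H2 | ].
    change (fun x0 : R => m1 x0) with m1; simpl in *.
    apply Rminus_diag_uniq.
    (* The difference of the two sides is [4 sg] times Kummer's equation at [sg x^2]; in the odd
       case below the factor is [4 sg x]. *)
    transitivity (4 * sg * (sg * (x * (x * 1)) * Derive m1 (sg * (x * (x * 1)))
      + (1 / 2 - sg * (x * (x * 1))) * m1 (sg * (x * (x * 1)))
      - p * m (sg * (x * (x * 1))))); [field | rewrite H3; ring].
Qed.

Lemma kummer_odd_sol p sg x :
  lin_sol (2 * sg) (sg * (4 * p - 2))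
    (fun y => y * kummerM p (3 / 2) (sg * y ^ 2))
    (fun y => kummerM p (3 / 2) (sg * y ^ 2)
              + 2 * sg * y ^ 2 * Derive (kummerM p (3 / 2)) (sg * y ^ 2)) x.
Proof.
  assert (H1 := fun z => ex_intro _ _ (is_derive_kummerM p (3 / 2) z ltac:(lra))
                 : ex_derive (kummerM p (3 / 2)) z).
  assert (H2 := fun z => ex_intro _ _ (is_derive2_kummerM p (3 / 2) z ltac:(lra))
                 : ex_derive (Derive (kummerM p (3 / 2))) z).
  assert (H3 := kummer_equation p (3 / 2) (sg * x ^ 2) ltac:(lra)).
  revert H1 H2 H3; generalize (kummerM p (3 / 2)); intros m H1 H2 H3.
  split.
  - auto_derive; [apply H1 | ].
    change (fun x0 : R => m x0) with m; simpl; ring.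
  - auto_derive; [repeat split; [apply H1 | apply H2] | ].
    change (fun x0 : R => m x0) with m.
    change (fun x0 : R => Derive m x0) with (Derive m).
    simpl in *.
    apply Rminus_diag_uniq.
    transitivity (4 * sg * x * (sg * (x * (x * 1)) * Derive (Derive m) (sg * (x * (x * 1)))
      + (3 / 2 - sg * (x * (x * 1))) * Derive m (sg * (x * (x * 1)))
      - p * m (sg * (x * (x * 1))))); [field | rewrite H3; ring].
Qed.

(** Two differentiations of [exp (- y^2)] contribute [- 2 g - 4 y g' + 4 y^2 g], which turns the
    growing equation of the series in [y^2] into the similarity equation. *)
Lemma lin_sol_gauss alpha g g1 x :
  lin_sol 2 (2 + 2 * alpha) g g1 x ->
  lin_sol (-2) (2 * alpha)
    (fun y => exp (- y ^ 2) * g y)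
    (fun y => exp (- y ^ 2) * (g1 y - 2 * y * g y)) x.
Proof.
  intros [H1 H2].
  assert (E1 := is_derive_unique _ _ _ H1).
  assert (E2 := is_derive_unique _ _ _ H2).
  split; auto_derive; try (repeat split; eexists; eassumption).
  - change (fun x0 : R => g x0) with g; rewrite E1; simpl; ring.
  - change (fun x0 : R => g x0) with g; change (fun x0 : R => g1 x0) with g1.
    rewrite E1, E2; simpl; ring.
Qed.

Lemma zero_derive_const f lo hi :
  (forall x, lo < x < hi -> is_derive f x 0) ->
  forall x y, lo < x < hi -> lo < y < hi -> f x = f y.
Proof.
  intros H.
  assert (K : forall x y, lo < x < hi -> lo < y < hi -> x < y -> f x = f y).
  { intros x y hx hy hxy; apply eq_is_derive; [|exact hxy].
    intros t ht; apply H; lra. }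
  intros x y hx hy; destruct (Rtotal_order x y) as [h|[h|h]].
  - auto.
  - now rewrite h.
  - symmetry; auto.
Qed.

(** Liouville's formula: the Wronskian satisfies [w' = b x w], so its product with
    [exp (- b x^2 / 2)] has zero derivative. *)
Lemma wronskian_lin_sol b c f f1 g g1 lo hi : lo < hi ->
  (forall x, lo < x < hi -> lin_sol b c f f1 x) ->
  (forall x, lo < x < hi -> lin_sol b c g g1 x) ->
  exists C, forall x, lo < x < hi ->
    f x * g1 x - f1 x * g x = C * exp (b * x ^ 2 / 2).
Proof.
  intros hlh Hf Hg.
  set (W := fun x => exp (- (b * x ^ 2 / 2)) * (f x * g1 x - f1 x * g x)).
  assert (HW : forall x, lo < x < hi -> is_derive W x 0).
  { intros x hx; destruct (Hf x hx) as [Hf1 Hf2]; destruct (Hg x hx) as [Hg1 Hg2].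
    unfold W; auto_derive; [repeat split; eexists; eassumption|].
    change (fun x0 : R => g x0) with g; change (fun x0 : R => g1 x0) with g1.
    change (fun x0 : R => f x0) with f; change (fun x0 : R => f1 x0) with f1.
    rewrite (is_derive_unique _ _ _ Hf1), (is_derive_unique _ _ _ Hf2),
      (is_derive_unique _ _ _ Hg1), (is_derive_unique _ _ _ Hg2).
    simpl; field. }
  exists (W ((lo + hi) / 2)); intros x hx.
  rewrite <- (zero_derive_const W lo hi HW x ((lo + hi) / 2) hx) by lra.
  unfold W; rewrite (Rmult_comm (exp _)), Rmult_assoc, <- exp_plus, Rplus_opp_l.
  rewrite exp_0; ring.
Qed.

(** Cramer's rule: [c1] and [c2] are the constants in Liouville's formula for the pairs [(f, d)] and
    [(e, f)], while the pair [(e, d)] has constant 1. *)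
Lemma lin_sol_span b c e e1 d d1 f f1 lo hi : lo < hi ->
  (forall x, lo < x < hi -> lin_sol b c e e1 x) ->
  (forall x, lo < x < hi -> lin_sol b c d d1 x) ->
  (forall x, lo < x < hi -> e x * d1 x - e1 x * d x = exp (b * x ^ 2 / 2)) ->
  (forall x, lo < x < hi -> lin_sol b c f f1 x) ->
  exists c1 c2, forall x, lo < x < hi ->
    f x = c1 * e x + c2 * d x /\ f1 x = c1 * e1 x + c2 * d1 x.
Proof.
  intros hlh He Hd HW Hf.
  destruct (wronskian_lin_sol b c f f1 d d1 lo hi hlh Hf Hd) as [c1 H1].
  destruct (wronskian_lin_sol b c e e1 f f1 lo hi hlh He Hf) as [c2 H2].
  exists c1, c2; intros x hx.
  specialize (H1 x hx); specialize (H2 x hx); specialize (HW x hx).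
  assert (Hp := exp_pos (b * x ^ 2 / 2)).
  split; apply (Rmult_eq_reg_r (exp (b * x ^ 2 / 2))); try lra.
  - replace ((c1 * e x + c2 * d x) * exp (b * x ^ 2 / 2)) with
      (c1 * exp (b * x ^ 2 / 2) * e x + c2 * exp (b * x ^ 2 / 2) * d x) by ring.
    rewrite <- H1, <- H2, <- HW; ring.
  - replace ((c1 * e1 x + c2 * d1 x) * exp (b * x ^ 2 / 2)) with
      (c1 * exp (b * x ^ 2 / 2) * e1 x + c2 * exp (b * x ^ 2 / 2) * d1 x) by ring.
    rewrite <- H1, <- H2, <- HW; ring.
Qed.

(** * A fundamental system of the similarity equation, and Kummer's transformation *)

Section Basis.

Variable alpha : R.

Definition even_part (y : R) : R := kummerM (alpha / 2 + 1 / 2) (1 / 2) (y ^ 2).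
Definition odd_part (y : R) : R := y * kummerM (alpha / 2 + 1) (3 / 2) (y ^ 2).

Definition gauss_even (y : R) : R := exp (- y ^ 2) * even_part y.
Definition gauss_odd (y : R) : R := exp (- y ^ 2) * odd_part y.
(** This and [dgauss_odd] are the derivatives of [gauss_even] and [gauss_odd], in the form that
    [lin_sol_gauss] delivers. *)
Definition dgauss_even (y : R) : R :=
  exp (- y ^ 2) * (2 * y * Derive (kummerM (alpha / 2 + 1 / 2) (1 / 2)) (y ^ 2)
                   - 2 * y * even_part y).
Definition dgauss_odd (y : R) : R :=
  exp (- y ^ 2) * (kummerM (alpha / 2 + 1) (3 / 2) (y ^ 2)
                   + 2 * y ^ 2 * Derive (kummerM (alpha / 2 + 1) (3 / 2)) (y ^ 2)
                   - 2 * y * odd_part y).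

Lemma gauss_even_sol x : lin_sol (-2) (2 * alpha) gauss_even dgauss_even x.
Proof.
  apply lin_sol_gauss.
  assert (H := kummer_even_sol (alpha / 2 + 1 / 2) 1 x).
  replace (4 * 1 * (alpha / 2 + 1 / 2)) with (2 + 2 * alpha) in H by field.
  rewrite Rmult_1_r in H.
  revert H; apply lin_sol_ext; intros y; unfold even_part; now rewrite !Rmult_1_l, ?Rmult_1_r.
Qed.

Lemma gauss_odd_sol x : lin_sol (-2) (2 * alpha) gauss_odd dgauss_odd x.
Proof.
  apply lin_sol_gauss.
  assert (H := kummer_odd_sol (alpha / 2 + 1) 1 x).
  replace (1 * (4 * (alpha / 2 + 1) - 2)) with (2 + 2 * alpha) in H by field.
  rewrite Rmult_1_r in H.
  revert H; apply lin_sol_ext; intros y; unfold odd_part; now rewrite !Rmult_1_l, ?Rmult_1_r.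
Qed.

Lemma gauss_even_0 : gauss_even 0 = 1.
Proof.
  unfold gauss_even, even_part; rewrite pow_i, Ropp_0, exp_0, kummerM_0 by lia; ring.
Qed.

Lemma gauss_odd_0 : gauss_odd 0 = 0.
Proof. unfold gauss_odd, odd_part; ring. Qed.

Lemma dgauss_even_0 : dgauss_even 0 = 0.
Proof. unfold dgauss_even; ring. Qed.

Lemma dgauss_odd_0 : dgauss_odd 0 = 1.
Proof.
  unfold dgauss_odd; rewrite pow_i, Ropp_0, exp_0, kummerM_0 by lia; ring.
Qed.

(** The interval [(- r, r)] contains both [x] and 0, and the initial data [(1, 0)] and [(0, 1)] at 0
    fix the constant in Liouville's formula. *)
Lemma gauss_wronskian x : gauss_even x * dgauss_odd x - dgauss_even x * gauss_odd x = exp (- x ^ 2).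
Proof.
  set (r := Rabs x + 1).
  assert (Hr : 0 < r) by (pose proof (Rabs_pos x); unfold r; lra).
  destruct (wronskian_lin_sol (-2) (2 * alpha) gauss_even dgauss_even gauss_odd
    dgauss_odd (- r) r) as [C HC].
  - lra.
  - intros; apply gauss_even_sol.
  - intros; apply gauss_odd_sol.
  - assert (H0 := HC 0 ltac:(lra)).
    rewrite gauss_even_0, gauss_odd_0, dgauss_even_0, dgauss_odd_0 in H0.
    replace (-2 * 0 ^ 2 / 2) with 0 in H0 by field; rewrite exp_0 in H0.
    rewrite HC.
    + replace C with 1 by lra; rewrite Rmult_1_l; f_equal; field.
    + destruct (Rabs_def2 x r) as [h1 h2]; [unfold r; lra | lra].
Qed.

Lemma gauss_span f f1 lo hi : lo < hi ->
  (forall x, lo < x < hi -> lin_sol (-2) (2 * alpha) f f1 x) ->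
  exists c1 c2, forall x, lo < x < hi ->
    f x = c1 * gauss_even x + c2 * gauss_odd x /\ f1 x = c1 * dgauss_even x + c2 * dgauss_odd x.
Proof.
  intros h H; apply (lin_sol_span (-2) (2 * alpha)); auto.
  - intros; apply gauss_even_sol.
  - intros; apply gauss_odd_sol.
  - intros x _; rewrite gauss_wronskian; f_equal; field.
Qed.

Lemma gauss_span_initial f f1 :
  (forall x, lin_sol (-2) (2 * alpha) f f1 x) ->
  forall x, f x = f 0 * gauss_even x + f1 0 * gauss_odd x.
Proof.
  intros H x.
  set (r := Rabs x + 1).
  assert (Hr : 0 < r) by (pose proof (Rabs_pos x); unfold r; lra).
  destruct (gauss_span f f1 (- r) r) as (c1 & c2 & Hc); [lra | auto |].
  destruct (Hc 0) as [H0 H1]; [lra|].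
  rewrite gauss_even_0, gauss_odd_0 in H0; rewrite dgauss_even_0, dgauss_odd_0 in H1.
  rewrite H0, H1.
  destruct (Hc x) as [Hx _].
  - destruct (Rabs_def2 x r) as [h1 h2]; [unfold r; lra | lra].
  - rewrite Hx; ring.
Qed.

(* Kummer's transformation [M(q-p,q,-z) = e^(-z) M(p,q,z)], obtained from
   uniqueness for the initial value problem. *)
Lemma kummer_transformation_even x :
  kummerM (- (alpha / 2)) (1 / 2) (- x ^ 2) = exp (- x ^ 2) * even_part x.
Proof.
  (* With [sg = -1] the series in [- y^2] solves the similarity equation without an exponential
     factor, and it has the initial data of [gauss_even]. *)
  assert (H := kummer_even_sol (- (alpha / 2)) (-1)).
  replace (4 * -1 * - (alpha / 2)) with (2 * alpha) in H by field.
  replace (2 * -1) with (-2) in H by ring.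
  apply gauss_span_initial with (x := x) in H.
  rewrite pow_i, Rmult_0_r, kummerM_0 in H by lia.
  replace (-1 * x ^ 2) with (- x ^ 2) in H by ring.
  rewrite H; unfold gauss_even; ring.
Qed.

Lemma kummer_transformation_odd x :
  x * kummerM (- (alpha / 2) + 1 / 2) (3 / 2) (- x ^ 2) = exp (- x ^ 2) * odd_part x.
Proof.
  assert (H := kummer_odd_sol (- (alpha / 2) + 1 / 2) (-1)).
  replace (-1 * (4 * (- (alpha / 2) + 1 / 2) - 2)) with (2 * alpha) in H by field.
  replace (2 * -1) with (-2) in H by ring.
  apply gauss_span_initial with (x := x) in H.
  rewrite pow_i, Rmult_0_r, kummerM_0 in H by lia.
  replace (-1 * x ^ 2) with (- x ^ 2) in H by ring.
  rewrite H; unfold gauss_odd; ring.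
Qed.

End Basis.

(** * Derivatives relative to a segment *)

Lemma is_derive_within_eps D f x l :
  is_derive_within D f x l <->
  forall eps, 0 < eps -> exists d, 0 < d /\
    forall y, D y -> y <> x -> Rabs (y - x) < d ->
      Rabs ((f y - f x) / (y - x) - l) < eps.
Proof.
  split.
  - intros H eps heps.
    destruct (H (fun v => Rabs (v - l) < eps)) as [d Hd].
    { exists (mkposreal eps heps); intros v hv; exact hv. }
    exists d; split; [apply cond_pos|].
    intros y hy hyx hyd; exact (Hd y hyd hyx hy).
  - intros H P [eps HP].
    destruct (H eps (cond_pos eps)) as (d & hd & Hd).
    exists (mkposreal d hd); intros y hyd hyx hy.
    apply HP; exact (Hd y hy hyx hyd).
Qed.

(** Difference quotients within [D] see only values on [D]. Hence [u], known only for
    [0 <= x <= s t], may be replaced by a smooth formula at the endpoints too. *)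
Lemma is_derive_within_smooth D f g x l : D x ->
  (forall y, D y -> f y = g y) -> is_derive g x l -> is_derive_within D f x l.
Proof.
  intros hx Hfg Hg; apply is_derive_within_eps; intros eps heps.
  apply is_derive_Reals in Hg.
  destruct (Hg eps heps) as [d Hd].
  exists d; split; [apply cond_pos|].
  intros y hy hyx hyd.
  rewrite !Hfg by assumption.
  specialize (Hd (y - x) ltac:(lra) hyd).
  replace (x + (y - x)) with y in Hd by ring; exact Hd.
Qed.

Lemma is_derive_within_interior D f x l :
  locally x D -> is_derive_within D f x l -> is_derive f x l.
Proof.
  intros [d0 H0] H; apply is_derive_Reals; intros eps heps.
  rewrite is_derive_within_eps in H.
  destruct (H eps heps) as (d & hd & Hd).
  assert (hm : 0 < Rmin d d0) by (apply Rmin_pos; [exact hd | apply cond_pos]).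
  exists (mkposreal _ hm); intros h hh hhd; simpl in hhd.
  assert (E : x + h - x = h) by ring.
  assert (L1 := Rmin_l d d0); assert (L2 := Rmin_r d d0).
  specialize (Hd (x + h)); rewrite E in Hd; apply Hd; [|lra|lra].
  apply H0; change (Rabs (x + h - x) < d0); rewrite E; lra.
Qed.

(** At an accumulation point of [D] one nearby difference quotient is close to both limits. This
    identifies the existentially given derivatives in the boundary conditions. *)
Lemma is_derive_within_unique D f x l1 l2 :
  (forall d, 0 < d -> exists y, D y /\ y <> x /\ Rabs (y - x) < d) ->
  is_derive_within D f x l1 -> is_derive_within D f x l2 -> l1 = l2.
Proof.
  intros Hacc H1 H2; rewrite is_derive_within_eps in H1, H2.
  apply cond_eq; intros eps heps.
  destruct (H1 (eps / 2) ltac:(lra)) as (d1 & h1 & K1).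
  destruct (H2 (eps / 2) ltac:(lra)) as (d2 & h2 & K2).
  destruct (Hacc (Rmin d1 d2) (Rmin_pos _ _ h1 h2)) as (y & hy & hyx & hyd).
  assert (L1 := Rmin_l d1 d2); assert (L2 := Rmin_r d1 d2).
  specialize (K1 y hy hyx ltac:(lra)); specialize (K2 y hy hyx ltac:(lra)).
  apply Rabs_def2 in K1; apply Rabs_def2 in K2; apply Rabs_def1; lra.
Qed.

Lemma is_derive_within_continuous D f x l : is_derive_within D f x l ->
  forall eps, 0 < eps -> exists d, 0 < d /\
    forall y, D y -> Rabs (y - x) < d -> Rabs (f y - f x) < eps.
Proof.
  intros H eps heps; rewrite is_derive_within_eps in H.
  (* Tolerance 1 for the difference quotient gives the local Lipschitz constant [|l| + 1]. *)
  destruct (H 1 Rlt_0_1) as (d & hd & Hd).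
  assert (Hl := Rabs_pos l).
  exists (Rmin d (eps / (Rabs l + 1))); split.
  { apply Rmin_pos; [exact hd | apply Rdiv_lt_0_compat; lra]. }
  intros y hy hyd.
  assert (L1 := Rmin_l d (eps / (Rabs l + 1))).
  assert (L2 := Rmin_r d (eps / (Rabs l + 1))).
  destruct (Req_dec y x) as [->|hyx].
  { rewrite Rminus_diag, Rabs_R0; exact heps. }
  specialize (Hd y hy hyx ltac:(lra)).
  assert (Hq : Rabs ((f y - f x) / (y - x)) < Rabs l + 1).
  { replace ((f y - f x) / (y - x)) with (((f y - f x) / (y - x) - l) + l) by ring.
    eapply Rle_lt_trans; [apply Rabs_triang | lra]. }
  replace (f y - f x) with ((f y - f x) / (y - x) * (y - x)) by (field; lra).
  rewrite Rabs_mult.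
  apply Rle_lt_trans with ((Rabs l + 1) * Rabs (y - x)).
  - apply Rmult_le_compat_r; [apply Rabs_pos | lra].
  - apply Rlt_le_trans with ((Rabs l + 1) * (eps / (Rabs l + 1))).
    + apply Rmult_lt_compat_l; lra.
    + right; field; lra.
Qed.

Lemma segment_left_limit_point c d : c < d ->
  forall e, 0 < e -> exists y, c < y < d /\ y <> c /\ Rabs (y - c) < e.
Proof.
  intros hcd e he.
  assert (hm : 0 < Rmin (d - c) e) by (apply Rmin_pos; lra).
  assert (L1 := Rmin_l (d - c) e); assert (L2 := Rmin_r (d - c) e).
  exists (c + Rmin (d - c) e / 2); repeat split; try lra.
  rewrite Rabs_pos_eq; lra.
Qed.

Lemma segment_right_limit_point c d : c < d ->
  forall e, 0 < e -> exists y, c < y < d /\ y <> d /\ Rabs (y - d) < e.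
Proof.
  intros hcd e he.
  assert (hm : 0 < Rmin (d - c) e) by (apply Rmin_pos; lra).
  assert (L1 := Rmin_l (d - c) e); assert (L2 := Rmin_r (d - c) e).
  exists (d - Rmin (d - c) e / 2); repeat split; try lra.
  rewrite Rabs_left; lra.
Qed.

Lemma is_derive_within_unique_left c d f l1 l2 : c < d ->
  is_derive_within (segment c d) f c l1 -> is_derive_within (segment c d) f c l2 ->
  l1 = l2.
Proof.
  intros hcd; apply is_derive_within_unique; intros e he.
  destruct (segment_left_limit_point c d hcd e he) as (y & hy & hyc & hye).
  exists y; split; [split; lra | split; assumption].
Qed.

Lemma is_derive_within_unique_right c d f l1 l2 : c < d ->
  is_derive_within (segment c d) f d l1 -> is_derive_within (segment c d) f d l2 ->
  l1 = l2.
Proof.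
  intros hcd; apply is_derive_within_unique; intros e he.
  destruct (segment_right_limit_point c d hcd e he) as (y & hy & hyc & hye).
  exists y; split; [split; lra | split; assumption].
Qed.

(** Both functions are continuous within the segment and its interior is dense in it. This carries
    the formula for the profile to the endpoints, where the boundary conditions live. *)
Lemma segment_eq_closure c d f g f1 g1 : c < d ->
  (forall x, segment c d x -> is_derive_within (segment c d) f x (f1 x)) ->
  (forall x, segment c d x -> is_derive_within (segment c d) g x (g1 x)) ->
  (forall x, c < x < d -> f x = g x) ->
  forall x, segment c d x -> f x = g x.
Proof.
  intros hcd Hf Hg Heq x hx.
  assert (Hacc : forall e, 0 < e -> exists y, c < y < d /\ Rabs (y - x) < e).
  { intros e he; destruct hx as [hx1 hx2].
    destruct (Rle_lt_or_eq_dec _ _ hx1) as [h1| <-].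
    - destruct (Rle_lt_or_eq_dec _ _ hx2) as [h2| ->].
      + exists x; rewrite Rminus_diag, Rabs_R0; lra.
      + destruct (segment_right_limit_point c d hcd e he) as (y & ? & _ & ?); eauto.
    - destruct (segment_left_limit_point c d hcd e he) as (y & ? & _ & ?); eauto. }
  apply cond_eq; intros eps heps.
  destruct (is_derive_within_continuous _ _ _ _ (Hf x hx) (eps / 2) ltac:(lra))
    as (d1 & h1 & K1).
  destruct (is_derive_within_continuous _ _ _ _ (Hg x hx) (eps / 2) ltac:(lra))
    as (d2 & h2 & K2).
  destruct (Hacc (Rmin d1 d2) (Rmin_pos _ _ h1 h2)) as (y & hy & hyd).
  assert (L1 := Rmin_l d1 d2); assert (L2 := Rmin_r d1 d2).
  assert (hys : segment c d y) by (split; lra).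
  specialize (K1 y hys ltac:(lra)); specialize (K2 y hys ltac:(lra)).
  rewrite (Heq y hy) in K1.
  apply Rabs_def2 in K1; apply Rabs_def2 in K2; apply Rabs_def1; lra.
Qed.

(** * The equation for the front coefficient *)

Lemma exp_nondecreasing x y : x <= y -> exp x <= exp y.
Proof.
  intros [h| ->]; [left; apply exp_increasing, h | right; reflexivity].
Qed.

Section Growth.

Variable alpha : R.
Hypothesis halpha : 0 <= alpha.

Lemma even_part_increasing x y : 0 <= x <= y ->
  even_part alpha x <= even_part alpha y.
Proof.
  intros h; apply kummerM_increasing; try lra.
  split; [apply pow2_ge_0 | apply pow_incr; lra].
Qed.

Lemma even_part_ge_1 x : 1 <= even_part alpha x.
Proof. apply kummerM_ge_1; try lra; apply pow2_ge_0. Qed.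

Lemma odd_part_increasing x y : 0 <= x <= y ->
  odd_part alpha x <= odd_part alpha y.
Proof.
  intros h; apply Rmult_le_compat; try lra.
  - apply Rle_trans with 1; [lra|].
    apply kummerM_ge_1; try lra; apply pow2_ge_0.
  - apply kummerM_increasing; try lra.
    split; [apply pow2_ge_0 | apply pow_incr; lra].
Qed.

Lemma odd_part_pos x : 0 < x -> 0 < odd_part alpha x.
Proof.
  intros hx; apply Rmult_lt_0_compat; [exact hx|].
  apply Rlt_le_trans with 1; [lra|].
  apply kummerM_ge_1; try lra; apply pow2_ge_0.
Qed.

Variables kap lam p : R.
Hypotheses (hkap : 0 <= kap) (hlam : 0 <= lam) (hp : 0 < p).

(** With [N] the product of [gamma] and the powers of 2 and [a], the equation of (P) is
    [front_map z = k uinf / N] for the weights [k / (2 a h0)] and [lambda]; that of (P_D) is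
    [front_map z = k u0 / N] for the weights 0 and 1. *)
Definition front_map (z : R) : R :=
  Rpower z p * (kap * even_part alpha z + lam * odd_part alpha z).

(** The power is positive and strictly increasing, the bracket is nondecreasing, and one nonzero
    weight makes the bracket positive. *)
Lemma front_map_increasing x y : 0 < kap + lam -> 0 < x < y ->
  front_map x < front_map y.
Proof.
  intros hkl hxy; unfold front_map.
  assert (Hpow : Rpower x p < Rpower y p) by (apply Rlt_Rpower_l; lra).
  assert (Hx : 0 < Rpower x p) by apply exp_pos.
  assert (A1 := even_part_increasing x y ltac:(lra)).
  assert (B1 := odd_part_increasing x y ltac:(lra)).
  assert (A0 := even_part_ge_1 x).
  assert (B0 := odd_part_pos x ltac:(lra)).
  assert (Hle : kap * even_part alpha x + lam * odd_part alpha x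
                <= kap * even_part alpha y + lam * odd_part alpha y) by nra.
  assert (Hpos : 0 < kap * even_part alpha x + lam * odd_part alpha x).
  { destruct (Rle_lt_or_eq_dec _ _ hkap) as [h| <-].
    - assert (0 < kap * even_part alpha x) by nra.
      assert (0 <= lam * odd_part alpha x) by nra. lra.
    - assert (0 < lam * odd_part alpha x) by nra. lra. }
  nra.
Qed.

Lemma front_map_inj x y : 0 < kap + lam -> 0 < x -> 0 < y ->
  front_map x = front_map y -> x = y.
Proof.
  intros hkl hx hy He.
  destruct (Rtotal_order x y) as [h|[h|h]]; [|exact h|].
  - assert (K := front_map_increasing x y hkl (conj hx h)); lra.
  - assert (K := front_map_increasing y x hkl (conj hy h)); lra.
Qed.

(** The substitution [z = exp v] keeps the base of the power positive, so the intermediate value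
    theorem can be applied on the whole line. *)
Lemma front_map_exp_continuous w : continuity_pt (fun v => front_map (exp v)) w.
Proof.
  apply continuity_pt_filterlim, (ex_derive_continuous (fun v => front_map (exp v))).
  unfold front_map, Rpower, even_part, odd_part.
  assert (H1 := fun z => ex_intro _ _ (is_derive_kummerM (alpha / 2 + 1 / 2) (1 / 2) z ltac:(lra))
                 : ex_derive (kummerM (alpha / 2 + 1 / 2) (1 / 2)) z).
  assert (H2 := fun z => ex_intro _ _ (is_derive_kummerM (alpha / 2 + 1) (3 / 2) z ltac:(lra))
                 : ex_derive (kummerM (alpha / 2 + 1) (3 / 2)) z).
  auto_derive; repeat split; [apply exp_pos | apply H1 | apply H2].
Qed.

Lemma front_map_surj C : 0 < kap -> 0 < C -> exists z, 0 < z /\ front_map z = C.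
Proof.
  intros hk hC.
  set (K := kap * even_part alpha 1 + lam * odd_part alpha 1).
  assert (A1 := even_part_ge_1 1).
  assert (B1 := odd_part_pos 1 Rlt_0_1).
  assert (HK : 0 < K) by (unfold K; nra).
  assert (Hroot : forall c, 0 < c -> Rpower (exp (ln c / p)) p = c).
  { intros c hc; unfold Rpower; rewrite ln_exp.
    replace (p * (ln c / p)) with (ln c) by (field; lra); apply exp_ln, hc. }
  (* For [z <= 1] the bracket is at most [K], so [z = min (1, (C / K)^(1/p))] gives a value at most
     [C]. The bracket is always at least [kap], so [z = (C / kap)^(1/p)] gives a value at least
     [C]. *)
  set (w1 := Rmin 0 (ln (C / K) / p)).
  set (w2 := ln (C / kap) / p).
  assert (HCK : 0 < C / K) by (apply Rdiv_lt_0_compat; lra).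
  assert (HCk : 0 < C / kap) by (apply Rdiv_lt_0_compat; lra).
  assert (L1 : front_map (exp w1) <= C).
  { assert (h0 : w1 <= 0) by apply Rmin_l.
    assert (h1 : w1 <= ln (C / K) / p) by apply Rmin_r.
    assert (he : exp w1 <= 1) by (rewrite <- exp_0; apply exp_nondecreasing, h0).
    assert (hp0 := exp_pos w1).
    assert (A := even_part_increasing (exp w1) 1 ltac:(lra)).
    assert (B := odd_part_increasing (exp w1) 1 ltac:(lra)).
    apply Rle_trans with (C / K * K); [|right; field; lra].
    unfold front_map; apply Rmult_le_compat.
    - left; apply exp_pos.
    - assert (A0 := even_part_ge_1 (exp w1)).
      assert (B0 := odd_part_pos (exp w1) hp0); nra.
    - rewrite <- (Hroot (C / K) HCK); apply Rle_Rpower_l; [lra|].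
      split; [exact hp0 | apply exp_nondecreasing, h1].
    - unfold K; nra. }
  assert (L2 : C <= front_map (exp w2)).
  { unfold front_map, w2; rewrite Hroot by exact HCk.
    assert (A := even_part_ge_1 (exp (ln (C / kap) / p))).
    assert (B := odd_part_pos (exp (ln (C / kap) / p)) (exp_pos _)).
    apply Rle_trans with (C / kap * kap); [right; field; lra|].
    apply Rmult_le_compat_l; nra. }
  destruct (IVT_gen (fun v => front_map (exp v)) w1 w2 C) as (w & _ & Hw).
  - exact front_map_exp_continuous.
  - split.
    + eapply Rle_trans; [apply Rmin_l | exact L1].
    + eapply Rle_trans; [exact L2 | apply Rmax_r].
  - exists (exp w); split; [apply exp_pos | exact Hw].
Qed.

End Growth.

(** * Solutions of similarity type *)

Section Similarity.

Variables a alpha : R.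
Hypothesis ha : 0 < a.

Lemma is_derive_similarity_time f l x t : 0 < t ->
  is_derive f (x / (2 * a * sqrt t)) l ->
  is_derive (fun tau => Rpower tau (alpha / 2) * f (x / (2 * a * sqrt tau))) t
    (Rpower t (alpha / 2) / t *
       (alpha / 2 * f (x / (2 * a * sqrt t)) - x / (2 * a * sqrt t) / 2 * l)).
Proof.
  intros ht Hf.
  assert (hs := sqrt_lt_R0 t ht).
  unfold Rpower; auto_derive.
  - repeat split; try assumption; try (apply Rgt_not_eq; nra).
    eexists; exact Hf.
  - change (fun x0 : R => f x0) with f; fold (x / (2 * a * sqrt t)).
    rewrite (is_derive_unique _ _ _ Hf).
    set (T := exp (alpha / 2 * ln t)).
    (* Replacing [t] by the square of [r = sqrt t] leaves a rational identity in [r]. *)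
    assert (E : t = sqrt t * sqrt t) by (symmetry; apply sqrt_sqrt; lra).
    generalize (f (x / (2 * a * sqrt t))); intros F; clearbody T; clear Hf.
    generalize dependent (sqrt t); intros r hr E.
    rewrite E; field; lra.
Qed.

Lemma is_derive_similarity_space f l x t : 0 < t ->
  is_derive f (x / (2 * a * sqrt t)) l ->
  is_derive (fun y => Rpower t (alpha / 2) * f (y / (2 * a * sqrt t))) x
    (Rpower t (alpha / 2) / (2 * a * sqrt t) * l).
Proof.
  intros ht Hf.
  assert (hs := sqrt_lt_R0 t ht).
  auto_derive.
  - repeat split; try (apply Rgt_not_eq; nra). eexists; exact Hf.
  - change (fun x0 : R => f x0) with f; fold (x / (2 * a * sqrt t)).
    rewrite (is_derive_unique _ _ _ Hf); field; lra.
Qed.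

(** The profile [g] is exposed as a parameter and its regularity is stated separately, so that each
    condition on [(u, s)] can be translated into one on [g]. *)
Definition similar (xi : R) (u : R -> R -> R) (s g : R -> R) : Prop :=
  0 < xi /\
  (forall t, 0 < t -> s t = 2 * xi * a * sqrt t) /\
  forall x t, 0 < t -> 0 <= x <= s t ->
    u x t = Rpower t (alpha / 2) * g (x / (2 * a * sqrt t)).

(** A time derivative at fixed [x] needs the representation of [u] at nearby times. The front lies
    beyond [x] exactly when [sqrt tau] exceeds [r = x / (2 xi a)], an open condition on [tau]. *)
Lemma similar_front_locally xi u s g x t : similar xi u s g ->
  0 < t -> x < s t -> 0 < x -> locally t (fun tau => 0 < tau /\ x < s tau).
Proof.
  intros (hxi & Hs & _) ht hx hx0.
  rewrite Hs in hx by exact ht.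
  set (r := x / (2 * xi * a)).
  assert (hxa : 0 < 2 * xi * a) by nra.
  assert (hr : 0 < r) by (apply Rdiv_lt_0_compat; assumption).
  assert (Hr : forall v, r < v <-> x < 2 * xi * a * v).
  { intros v; unfold r; rewrite (Rlt_div_l x v _ hxa), (Rmult_comm v); reflexivity. }
  assert (hrt : r * r < t).
  { apply Hr in hx. rewrite <- (sqrt_sqrt t) by lra. nra. }
  exists (mkposreal (t - r * r) ltac:(lra)); intros tau htau.
  change (Rabs (tau - t) < t - r * r) in htau; apply Rabs_def2 in htau.
  assert (h0 : 0 < tau) by nra.
  split; [exact h0|].
  rewrite Hs by exact h0; apply Hr.
  rewrite <- (sqrt_square r) by lra; apply sqrt_lt_1; nra.
Qed.

Lemma similar_variable_range xi u s g x t : similar xi u s g ->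
  0 < t -> 0 < x < s t -> 0 < x / (2 * a * sqrt t) < xi.
Proof.
  intros (hxi & Hs & _) ht hx; rewrite Hs in hx by exact ht.
  assert (hs := sqrt_lt_R0 t ht).
  assert (h : 0 < 2 * a * sqrt t) by nra.
  split; [apply Rdiv_lt_0_compat; lra|].
  apply Rlt_div_l; [exact h | lra].
Qed.

Lemma similar_derivatives xi u s g g1 g2 : similar xi u s g ->
  (forall y, 0 < y < xi -> is_derive g y (g1 y)) ->
  (forall y, 0 < y < xi -> is_derive g1 y (g2 y)) ->
  forall x t, 0 < t -> 0 < x < s t ->
    let y := x / (2 * a * sqrt t) in
    is_derive (fun tau => u x tau) t
      (Rpower t (alpha / 2) / t * (alpha / 2 * g y - y / 2 * g1 y)) /\
    locally x (fun z => is_derive (fun w => u w t) z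
      (Rpower t (alpha / 2) / (2 * a * sqrt t) * g1 (z / (2 * a * sqrt t)))) /\
    is_derive (Derive (fun w => u w t)) x
      (Rpower t (alpha / 2) / (2 * a * sqrt t) / (2 * a * sqrt t) * g2 y).
Proof.
  intros Hsim Hg Hg1 x t ht hx y.
  assert (hy : 0 < y < xi) by exact (similar_variable_range _ _ _ _ _ _ Hsim ht hx).
  pose proof Hsim as (hxi & Hs & Hu).
  assert (Hloc : forall z, 0 < z < s t -> locally z (fun w => 0 < w < s t)).
  { intros z hz; apply filter_and; [apply open_gt | apply open_lt]; lra. }
  assert (Hx : forall z, 0 < z < s t -> is_derive (fun w => u w t) z
      (Rpower t (alpha / 2) / (2 * a * sqrt t) * g1 (z / (2 * a * sqrt t)))).
  { intros z hz.
    apply is_derive_ext_loc with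
      (fun w => Rpower t (alpha / 2) * g (w / (2 * a * sqrt t))).
    - generalize (Hloc z hz); apply filter_imp; intros w hw; symmetry; apply Hu; lra.
    - apply is_derive_similarity_space; [exact ht|]; apply Hg.
      exact (similar_variable_range _ _ _ _ _ _ Hsim ht hz). }
  split; [|split].
  - apply is_derive_ext_loc with
      (fun tau => Rpower tau (alpha / 2) * g (x / (2 * a * sqrt tau))).
    + generalize (similar_front_locally _ _ _ _ x t Hsim ht (proj2 hx) (proj1 hx)).
      apply filter_imp; intros tau [h1 h2]; symmetry; apply Hu; lra.
    + apply is_derive_similarity_time; [exact ht | apply Hg, hy].
  - generalize (Hloc x hx); apply filter_imp; exact Hx.
  - apply is_derive_ext_loc with
      (fun z => Rpower t (alpha / 2) / (2 * a * sqrt t) * g1 (z / (2 * a * sqrt t))).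
    + generalize (Hloc x hx); apply filter_imp; intros z hz.
      symmetry; apply is_derive_unique, Hx, hz.
    + assert (K := is_derive_similarity_space g1 (g2 y) x t ht (Hg1 y hy)).
      apply is_derive_scal with (k := / (2 * a * sqrt t)) in K.
      replace (Rpower t (alpha / 2) / (2 * a * sqrt t) / (2 * a * sqrt t) * g2 y)
        with (/ (2 * a * sqrt t) * (Rpower t (alpha / 2) / (2 * a * sqrt t) * g2 y))
        by (unfold Rdiv; ring).
      revert K; apply is_derive_ext; intros z; unfold Rdiv; simpl; ring.
Qed.

Lemma similar_heat_equation xi u s g g1 : similar xi u s g ->
  (forall y, 0 < y < xi -> lin_sol (-2) (2 * alpha) g g1 y) ->
  heat_equation a u s.
Proof.
  intros Hsim Hg x t ht hx.
  destruct (similar_derivatives xi u s g g1 (fun y => -2 * y * g1 y + 2 * alpha * g y)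
              Hsim (fun y hy => proj1 (Hg y hy)) (fun y hy => proj2 (Hg y hy)) x t ht hx)
    as (Ht & Hx & Hxx).
  split; [eexists; exact Ht|].
  split; [revert Hx; apply filter_imp; intros z hz; eexists; exact hz|].
  split; [eexists; exact Hxx|].
  etransitivity; [exact (is_derive_unique _ _ _ Ht)|].
  etransitivity; [|symmetry; apply f_equal; exact (is_derive_unique _ _ _ Hxx)].
  assert (hs := sqrt_lt_R0 t ht).
  assert (E : t = sqrt t * sqrt t) by (symmetry; apply sqrt_sqrt; lra).
  set (y := x / _); generalize dependent (Rpower t (alpha / 2)); intros T _ _ _.
  generalize (g y) (g1 y); intros v v1; clearbody y; clear Hsim hx.
  generalize dependent (sqrt t); intros r hr E; rewrite E; field; lra.
Qed.

Lemma heat_equation_profile xi u s g g1 g2 : similar xi u s g ->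
  (forall y, 0 < y < xi -> is_derive g y (g1 y)) ->
  (forall y, 0 < y < xi -> is_derive g1 y (g2 y)) ->
  heat_equation a u s ->
  forall y, 0 < y < xi -> lin_sol (-2) (2 * alpha) g g1 y.
Proof.
  intros Hsim Hg Hg1 Hheat y hy.
  assert (hs1 : s 1 = 2 * xi * a) by (rewrite (proj1 (proj2 Hsim)), sqrt_1; lra).
  (* At time 1 the point [2 a y] has similarity variable [y], and all powers of [t] equal 1. *)
  assert (hx : 0 < 2 * a * y < s 1) by (rewrite hs1; split; nra).
  destruct (similar_derivatives _ _ _ _ _ _ Hsim Hg Hg1 _ 1 Rlt_0_1 hx) as (Ht & _ & Hxx).
  destruct (Hheat _ 1 Rlt_0_1 hx) as (_ & _ & _ & H).
  apply (eq_trans (eq_sym (is_derive_unique _ _ _ Ht))) in H.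
  apply (fun E => eq_trans E (f_equal (Rmult (a ^ 2)) (is_derive_unique _ _ _ Hxx))) in H.
  rewrite sqrt_1 in H; replace (2 * a * y / (2 * a * 1)) with y in H by (field; lra).
  unfold Rpower in H; rewrite ln_1, Rmult_0_r, exp_0 in H.
  split; [apply Hg, hy|].
  replace (-2 * y * g1 y + 2 * alpha * g y) with (g2 y); [apply Hg1, hy|].
  replace (a ^ 2 * (1 / (2 * a * 1) / (2 * a * 1) * g2 y)) with (g2 y / 4) in H
    by (field; lra).
  lra.
Qed.

Definition comb (c1 c2 y : R) : R := c1 * gauss_even alpha y + c2 * gauss_odd alpha y.
Definition dcomb (c1 c2 y : R) : R := c1 * dgauss_even alpha y + c2 * dgauss_odd alpha y.

Lemma comb_sol c1 c2 y : lin_sol (-2) (2 * alpha) (comb c1 c2) (dcomb c1 c2) y.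
Proof.
  destruct (gauss_even_sol alpha y) as [H1 K1]; destruct (gauss_odd_sol alpha y) as [H2 K2].
  split.
  - apply (is_derive_plus (fun y => c1 * gauss_even alpha y) (fun y => c2 * gauss_odd alpha y));
      apply is_derive_scal; assumption.
  - replace (-2 * y * dcomb c1 c2 y + 2 * alpha * comb c1 c2 y) with
      (c1 * (-2 * y * dgauss_even alpha y + 2 * alpha * gauss_even alpha y)
       + c2 * (-2 * y * dgauss_odd alpha y + 2 * alpha * gauss_odd alpha y))
      by (unfold comb, dcomb; ring).
    apply (is_derive_plus (fun y => c1 * dgauss_even alpha y) (fun y => c2 * dgauss_odd alpha y));
      apply is_derive_scal; assumption.
Qed.

(** Every competing solution reduces to two constants: the heat equation gives the similarity
    equation on [(0, xi)], the fundamental system gives the formula there, and continuity extends it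
    to [[0, xi]]. *)
Lemma similarity_type_comb xi u s :
  similarity_type a alpha xi u s -> heat_equation a u s ->
  exists c1 c2, similar xi u s (comb c1 c2).
Proof.
  intros (hxi & Hs & phi & (f1 & f2 & D1 & D2 & _) & Hu) Hheat.
  assert (Hint : forall y, 0 < y < xi -> locally y (segment 0 xi)).
  { intros y hy; apply filter_imp with (fun w => 0 < w /\ w < xi).
    - intros w hw; split; lra.
    - apply filter_and; [apply open_gt | apply open_lt]; lra. }
  assert (Hsol : forall y, 0 < y < xi -> lin_sol (-2) (2 * alpha) phi f1 y).
  { apply (heat_equation_profile xi u s phi f1 f2); [repeat split; assumption | | | exact Hheat].
    - intros y hy; apply (is_derive_within_interior (segment 0 xi));
        [apply Hint, hy | apply D1; split; lra].
    - intros y hy; apply (is_derive_within_interior (segment 0 xi));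
        [apply Hint, hy | apply D2; split; lra]. }
  destruct (gauss_span alpha phi f1 0 xi hxi Hsol) as (c1 & c2 & Hc).
  exists c1, c2; split; [exact hxi | split; [exact Hs|]].
  intros x t ht hx; rewrite (Hu x t ht hx); f_equal.
  apply (segment_eq_closure 0 xi phi (comb c1 c2) f1 (dcomb c1 c2)); try assumption.
  - intros y hy; apply (is_derive_within_smooth _ _ (comb c1 c2));
      [exact hy | reflexivity | apply comb_sol].
  - intros y hy; apply Hc, hy.
  - assert (hs := sqrt_lt_R0 t ht); rewrite Hs in hx by exact ht.
    assert (h : 0 < 2 * a * sqrt t) by nra.
    split; [apply Rle_div_r | apply Rle_div_l]; lra.
Qed.

Lemma similar_similarity_type xi u s c1 c2 :
  similar xi u s (comb c1 c2) -> similarity_type a alpha xi u s.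
Proof.
  intros (hxi & Hs & Hu); split; [exact hxi | split; [exact Hs|]].
  exists (comb c1 c2); split; [|exact Hu].
  exists (dcomb c1 c2), (fun y => -2 * y * dcomb c1 c2 y + 2 * alpha * comb c1 c2 y).
  split; [|split].
  - intros y hy; apply (is_derive_within_smooth _ _ (comb c1 c2));
      [exact hy | reflexivity | apply comb_sol].
  - intros y hy; apply (is_derive_within_smooth _ _ (dcomb c1 c2));
      [exact hy | reflexivity | apply comb_sol].
  - apply continuous_on_forall; intros y _.
    apply (ex_derive_continuous
             (fun y => -2 * y * dcomb c1 c2 y + 2 * alpha * comb c1 c2 y)).
    destruct (comb_sol c1 c2 y) as [H1 H2].
    auto_derive; repeat split; eexists; eassumption.
Qed.

Lemma similar_front_pos xi u s g t : similar xi u s g -> 0 < t -> 0 < s t.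
Proof.
  intros (hxi & Hs & _) ht; rewrite Hs by exact ht.
  assert (hs := sqrt_lt_R0 t ht); assert (0 < xi * a) by nra; nra.
Qed.

Lemma similar_front_variable xi u s g t : similar xi u s g -> 0 < t ->
  s t / (2 * a * sqrt t) = xi.
Proof.
  intros (hxi & Hs & _) ht; rewrite Hs by exact ht.
  assert (hs := sqrt_lt_R0 t ht); field; lra.
Qed.

Lemma similar_space_derivative xi u s c1 c2 x t : similar xi u s (comb c1 c2) ->
  0 < t -> segment 0 (s t) x ->
  is_derive_within (segment 0 (s t)) (fun y => u y t) x
    (Rpower t (alpha / 2) / (2 * a * sqrt t) * dcomb c1 c2 (x / (2 * a * sqrt t))).
Proof.
  intros (hxi & Hs & Hu) ht hx.
  apply (is_derive_within_smooth _ _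
           (fun y => Rpower t (alpha / 2) * comb c1 c2 (y / (2 * a * sqrt t)))).
  - exact hx.
  - intros y hy; apply Hu; [exact ht | exact hy].
  - apply is_derive_similarity_space; [exact ht | apply comb_sol].
Qed.

Lemma similar_at_0 xi u s c1 c2 t : similar xi u s (comb c1 c2) -> 0 < t ->
  u 0 t = Rpower t (alpha / 2) * c1.
Proof.
  intros Hsim ht; assert (hst := similar_front_pos _ _ _ _ t Hsim ht).
  destruct Hsim as (_ & _ & Hu); rewrite Hu by lra.
  unfold comb; rewrite Rdiv_0_l, gauss_even_0, gauss_odd_0; ring.
Qed.

(** * The boundary conditions as algebraic relations between [c1], [c2] and [xi] *)

Lemma similar_dirichlet u0 xi u s c1 c2 : similar xi u s (comb c1 c2) ->
  dirichlet_condition u0 alpha u <-> c1 = u0.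
Proof.
  intros Hsim.
  assert (H := fun t => similar_at_0 xi u s c1 c2 t Hsim).
  split.
  - intros Hd; specialize (Hd 1 Rlt_0_1); rewrite H in Hd by lra.
    assert (hp := exp_pos (alpha / 2 * ln 1)); fold (Rpower 1 (alpha / 2)) in hp.
    nra.
  - intros <- t ht; rewrite H by exact ht; ring.
Qed.

Lemma similar_convective k h0 uinf lambda xi u s c1 c2 : 0 < h0 ->
  similar xi u s (comb c1 c2) ->
  convective_condition k h0 uinf lambda alpha u s <->
  k / (2 * a * h0) * c2 = lambda * c1 - uinf.
Proof.
  intros hh0 Hsim.
  assert (H := fun t => similar_at_0 xi u s c1 c2 t Hsim).
  assert (HD : forall t, 0 < t -> is_derive_within (segment 0 (s t)) (fun y => u y t) 0
     (Rpower t (alpha / 2) / (2 * a * sqrt t) * c2)).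
  { intros t ht; assert (hst := similar_front_pos _ _ _ _ t Hsim ht).
    replace c2 with (dcomb c1 c2 (0 / (2 * a * sqrt t))).
    - apply (similar_space_derivative xi); [exact Hsim | exact ht | split; lra].
    - unfold dcomb; rewrite Rdiv_0_l, dgauss_even_0, dgauss_odd_0; ring. }
  (* The defect of the condition is a positive function of [t] times a constant, so the instant
     [t = 1] decides for all times. *)
  assert (Heq : forall t, 0 < t ->
     k * (Rpower t (alpha / 2) / (2 * a * sqrt t) * c2)
     - h0 / sqrt t * (lambda * u 0 t - uinf * Rpower t (alpha / 2))
     = Rpower t (alpha / 2) * h0 / sqrt t
       * (k / (2 * a * h0) * c2 - (lambda * c1 - uinf))).
  { intros t ht; rewrite H by exact ht; assert (hs := sqrt_lt_R0 t ht); field; lra. }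
  split.
  - intros Hc; destruct (Hc 1 Rlt_0_1) as (ux & Hux & E).
    assert (hst := similar_front_pos _ _ _ _ 1 Hsim Rlt_0_1).
    rewrite (is_derive_within_unique_left _ _ _ _ _ hst Hux (HD 1 Rlt_0_1)) in E.
    specialize (Heq 1 Rlt_0_1); rewrite E, Rminus_diag in Heq.
    assert (hp := exp_pos (alpha / 2 * ln 1)); fold (Rpower 1 (alpha / 2)) in hp.
    symmetry in Heq; rewrite sqrt_1 in Heq; apply Rmult_integral in Heq.
    destruct Heq as [Heq|Heq]; [|lra].
    assert (0 < Rpower 1 (alpha / 2) * h0 / 1)
      by (rewrite Rdiv_1_r; apply Rmult_lt_0_compat; assumption).
    lra.
  - intros E t ht; eexists; split; [exact (HD t ht)|].
    apply Rminus_diag_uniq; rewrite Heq by exact ht; rewrite E; ring.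
Qed.

(** The powers of [t] on the left have total exponent [(beta - delta - 1) / 2], which is
    [(alpha - 1) / 2]. One factor 2 and one factor [a] come from the chain-rule denominator
    [2 a sqrt t]. The proof writes every base as an exponential and compares exponents. *)
Lemma stefan_powers gamma beta delta xi t :
  alpha = beta - delta -> 0 < xi -> 0 < t ->
  gamma * Rpower (2 * xi * a * sqrt t) beta * Rpower (xi * a / sqrt t) delta
    * (xi * a / sqrt t)
  = Rpower t (alpha / 2) / (2 * a * sqrt t) *
    (gamma * Rpower 2 (beta + 1) * Rpower a (beta + delta + 2)
     * Rpower xi (beta + delta + 1)).
Proof.
  intros hal hxi ht.
  assert (Hpe : forall v w, Rpower (exp v) w = exp (w * v))
    by (intros; unfold Rpower; now rewrite ln_exp).
  set (X := ln xi); set (A := ln a); set (L := ln 2); set (S := ln t).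
  assert (EX : xi = exp X) by (symmetry; apply exp_ln, hxi).
  assert (EA : a = exp A) by (symmetry; apply exp_ln, ha).
  assert (EL : 2 = exp L) by (symmetry; apply exp_ln; lra).
  assert (ES : t = exp S) by (symmetry; apply exp_ln, ht).
  assert (Er : sqrt t = exp (S / 2)).
  { apply sqrt_lem_1; [lra | left; apply exp_pos |].
    rewrite <- exp_plus, ES; f_equal; field. }
  replace (Rpower t (alpha / 2)) with (exp (alpha / 2 * S)) by reflexivity.
  replace (Rpower xi (beta + delta + 1)) with (exp ((beta + delta + 1) * X)) by reflexivity.
  replace (Rpower a (beta + delta + 2)) with (exp ((beta + delta + 2) * A)) by reflexivity.
  replace (Rpower 2 (beta + 1)) with (exp ((beta + 1) * L)) by reflexivity.
  rewrite Er.
  replace (2 * xi * a * exp (S / 2)) with (exp (L + X + A + S / 2))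
    by (rewrite !exp_plus, <- EL, <- EX, <- EA; ring).
  replace (2 * a * exp (S / 2)) with (exp (L + A + S / 2))
    by (rewrite !exp_plus, <- EL, <- EA; ring).
  replace (xi * a / exp (S / 2)) with (exp (X + A + - (S / 2)))
    by (rewrite !exp_plus, exp_Ropp, <- EX, <- EA; reflexivity).
  rewrite !Hpe.
  replace (exp (alpha / 2 * S) / exp (L + A + S / 2))
    with (exp (alpha / 2 * S) * exp (- (L + A + S / 2)))
    by (rewrite (exp_Ropp (L + A + S / 2)); reflexivity).
  replace (exp (alpha / 2 * S) * exp (- (L + A + S / 2)) *
     (gamma * exp ((beta + 1) * L) * exp ((beta + delta + 2) * A)
      * exp ((beta + delta + 1) * X)))
    with (gamma * (exp (alpha / 2 * S) * exp (- (L + A + S / 2)) *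
      exp ((beta + 1) * L) * exp ((beta + delta + 2) * A)
      * exp ((beta + delta + 1) * X))) by ring.
  rewrite !Rmult_assoc; f_equal; rewrite <- !exp_plus; f_equal.
  rewrite hal; field.
Qed.

Lemma similar_stefan k gamma beta delta xi u s c1 c2 :
  alpha = beta - delta -> similar xi u s (comb c1 c2) ->
  stefan_condition k gamma beta delta u s <->
  - k * dcomb c1 c2 xi =
    gamma * Rpower 2 (beta + 1) * Rpower a (beta + delta + 2)
    * Rpower xi (beta + delta + 1).
Proof.
  intros hal Hsim.
  assert (hxi := proj1 Hsim).
  assert (Hds : forall t, 0 < t -> is_derive s t (xi * a / sqrt t)).
  { intros t ht; assert (hs := sqrt_lt_R0 t ht).
    apply is_derive_ext_loc with (fun tau => 2 * xi * a * sqrt tau).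
    - generalize (open_gt 0 t ht); apply filter_imp; intros tau htau.
      symmetry; apply (proj1 (proj2 Hsim)), htau.
    - auto_derive; [exact ht | field; lra]. }
  assert (HD : forall t, 0 < t -> is_derive_within (segment 0 (s t)) (fun y => u y t) (s t)
     (Rpower t (alpha / 2) / (2 * a * sqrt t) * dcomb c1 c2 xi)).
  { intros t ht; assert (hst := similar_front_pos _ _ _ _ t Hsim ht).
    rewrite <- (similar_front_variable _ _ _ _ t Hsim ht).
    apply (similar_space_derivative xi); [exact Hsim | exact ht | split; lra]. }
  assert (Hpos : forall t, 0 < t -> 0 < Rpower t (alpha / 2) / (2 * a * sqrt t)).
  { intros t ht; assert (hs := sqrt_lt_R0 t ht).
    apply Rdiv_lt_0_compat; [apply exp_pos | nra]. }
  split.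
  - intros Hc; destruct (Hc 1 Rlt_0_1) as (ux & ds & Hux & Hs & E).
    assert (hst := similar_front_pos _ _ _ _ 1 Hsim Rlt_0_1).
    rewrite (is_derive_within_unique_right _ _ _ _ _ hst Hux (HD 1 Rlt_0_1)) in E.
    rewrite <- (is_derive_unique _ _ _ Hs), (is_derive_unique _ _ _ (Hds 1 Rlt_0_1)) in E.
    rewrite (proj1 (proj2 Hsim)), stefan_powers in E by (assumption || lra).
    apply (Rmult_eq_reg_l (Rpower 1 (alpha / 2) / (2 * a * sqrt 1)));
      [lra | apply Rgt_not_eq, Hpos, Rlt_0_1].
  - intros E t ht; eexists; eexists; split; [exact (HD t ht) | split; [exact (Hds t ht)|]].
    rewrite (proj1 (proj2 Hsim)), stefan_powers by (assumption || lra).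
    rewrite <- E; ring.
Qed.

Lemma similar_front_zero xi u s c1 c2 : similar xi u s (comb c1 c2) ->
  (forall t, 0 < t -> u (s t) t = 0) <->
  c1 * even_part alpha xi + c2 * odd_part alpha xi = 0.
Proof.
  intros Hsim.
  assert (Hg : forall t, 0 < t -> u (s t) t = Rpower t (alpha / 2) * exp (- xi ^ 2)
                * (c1 * even_part alpha xi + c2 * odd_part alpha xi)).
  { intros t ht; assert (hst := similar_front_pos _ _ _ _ t Hsim ht).
    rewrite (proj2 (proj2 Hsim)) by (assumption || lra).
    rewrite (similar_front_variable _ _ _ _ t Hsim ht).
    unfold comb, gauss_even, gauss_odd; ring. }
  split.
  - intros H; specialize (H 1 Rlt_0_1); rewrite Hg in H by lra.
    assert (hp := exp_pos (alpha / 2 * ln 1)); fold (Rpower 1 (alpha / 2)) in hp.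
    assert (hq := exp_pos (- xi ^ 2)).
    apply Rmult_integral in H; destruct H as [H|H]; [nra | exact H].
  - intros E t ht; rewrite Hg, E by exact ht; ring.
Qed.

(* The Wronskian turns the flux at the front into [- c1 / odd_part xi]. *)
Lemma dcomb_front xi c1 c2 :
  c1 * even_part alpha xi + c2 * odd_part alpha xi = 0 ->
  odd_part alpha xi * dcomb c1 c2 xi = - c1.
Proof.
  intros E.
  assert (W := gauss_wronskian alpha xi); unfold gauss_even, gauss_odd in W.
  assert (hq := exp_pos (- xi ^ 2)).
  apply (Rmult_eq_reg_l (exp (- xi ^ 2))); [|lra].
  unfold dcomb.
  transitivity (exp (- xi ^ 2) * (c1 * even_part alpha xi + c2 * odd_part alpha xi)
     * dgauss_odd alpha xi
     - c1 * (exp (- xi ^ 2) * even_part alpha xi * dgauss_odd alpha xi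
             - dgauss_even alpha xi * (exp (- xi ^ 2) * odd_part alpha xi))); [ring|].
  rewrite E, W; ring.
Qed.

(** The flux relation is multiplied by the positive number [odd_part alpha xi]; by [dcomb_front] the
    derivative of the profile then disappears. *)
Lemma similar_common_system k gamma beta delta xi u s c1 c2 :
  0 <= alpha -> alpha = beta - delta -> similar xi u s (comb c1 c2) ->
  common_system a k gamma beta delta u s <->
  s 0 = 0 /\ c1 * even_part alpha xi + c2 * odd_part alpha xi = 0 /\
  k * c1 = odd_part alpha xi *
    (gamma * Rpower 2 (beta + 1) * Rpower a (beta + delta + 2)
     * Rpower xi (beta + delta + 1)).
Proof.
  intros hal0 hal Hsim.
  assert (hB := odd_part_pos alpha hal0 xi (proj1 Hsim)).
  unfold common_system.
  rewrite (similar_front_zero _ _ _ _ _ Hsim), (similar_stefan _ _ _ _ _ _ _ _ _ hal Hsim).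
  split.
  - intros (_ & H1 & H2 & H3); split; [exact H3 | split; [exact H1|]].
    rewrite <- H2; assert (K := dcomb_front xi c1 c2 H1).
    replace (k * c1) with (- k * - c1) by ring; rewrite <- K; ring.
  - intros (H1 & H2 & H3); split; [|split; [exact H2 | split; [|exact H1]]].
    + apply (similar_heat_equation _ _ _ _ (dcomb c1 c2) Hsim); intros; apply comb_sol.
    + apply (Rmult_eq_reg_l (odd_part alpha xi)); [|lra].
      rewrite <- H3; assert (K := dcomb_front xi c1 c2 H2).
      replace (k * c1) with (- k * - c1) by ring; rewrite <- K; ring.
Qed.

Lemma similar_same_pair xi u u' s s' g :
  similar xi u s g -> similar xi u' s' g -> s 0 = 0 -> s' 0 = 0 ->
  same_pair u u' s s'.
Proof.
  intros (_ & Hs & Hu) (_ & Hs' & Hu') h h'.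
  assert (E : forall t, 0 <= t -> s' t = s t).
  { intros t [ht| <-]; [now rewrite Hs, Hs' | now rewrite h, h']. }
  split; [exact E|].
  intros x t ht hx; rewrite Hu, Hu' by (try rewrite E; lra); reflexivity.
Qed.

End Similarity.

(** * The coefficient equations without denominators, and the equivalence of the two problems *)

Lemma coefficient_equation K C D r : 0 < K -> 0 < D ->
  C / K * (1 / D) = r <-> C = D * (K * r).
Proof.
  intros hK hD; split.
  - intros <-; field; lra.
  - intros ->; field; lra.
Qed.

Lemma coefficient_P_iff a k gamma h0 uinf lambda beta delta alpha z :
  0 < a -> 0 < k -> 0 < gamma -> 0 < h0 -> 0 <= lambda -> 0 <= alpha ->
  coefficient_P a k gamma h0 uinf lambda beta delta alpha z <->
  0 < z /\ k * uinf =
    (k / (2 * a * h0) * even_part alpha z + lambda * odd_part alpha z) *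
    (gamma * Rpower 2 (beta + 1) * Rpower a (beta + delta + 2)
     * Rpower z (beta + delta + 1)).
Proof.
  intros ha hk hgamma hh0 hlambda hal.
  unfold coefficient_P.
  split; intros [hz E]; split; try exact hz; revert E;
    rewrite (Rmult_assoc lambda z);
    apply coefficient_equation.
  all: try (repeat apply Rmult_lt_0_compat; try apply exp_pos; exact hgamma).
  all: change (0 < k / (2 * a * h0) * even_part alpha z + lambda * odd_part alpha z).
  all: assert (hA := even_part_ge_1 alpha hal z).
  all: assert (hB := odd_part_pos alpha hal z hz).
  all: assert (hkap : 0 < k / (2 * a * h0)) by (apply Rdiv_lt_0_compat; nra).
  all: nra.
Qed.

Lemma coefficient_PD_iff a k gamma u0 beta delta alpha z :
  0 < a -> 0 < gamma -> 0 <= alpha ->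
  coefficient_PD a k gamma u0 beta delta alpha z <->
  0 < z /\ k * u0 = odd_part alpha z *
    (gamma * Rpower 2 (beta + 1) * Rpower a (beta + delta + 2)
     * Rpower z (beta + delta + 1)).
Proof.
  intros ha hgamma hal.
  unfold coefficient_PD.
  split; intros [hz E]; split; try exact hz; revert E;
    apply coefficient_equation.
  all: try (repeat apply Rmult_lt_0_compat; try apply exp_pos; exact hgamma).
  all: exact (odd_part_pos alpha hal z hz).
Qed.

Theorem theorem3p1
  (a k gamma h0 uinf u0 lambda beta delta alpha : R)
  (ha : 0 < a) (hk : 0 < k) (hgamma : 0 < gamma) (hh0 : 0 < h0)
  (huinf : 0 < uinf) (hu0 : 0 < u0) (hlambda : 0 <= lambda)
  (hbd : delta <= beta) (hbd1 : 0 < beta + delta + 1)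
  (halpha : alpha = beta - delta) :
  (exists! z : R, coefficient_P a k gamma h0 uinf lambda beta delta alpha z) /\
  forall xi : R,
    coefficient_P a k gamma h0 uinf lambda beta delta alpha xi ->
    u0 = uinf * xi * kummerM (- (alpha / 2) + 1 / 2) (3 / 2) (- xi ^ 2)
         / (k / (2 * a * h0) * kummerM (- (alpha / 2)) (1 / 2) (- xi ^ 2)
            + lambda * xi * kummerM (- (alpha / 2) + 1 / 2) (3 / 2) (- xi ^ 2)) ->
    (exists (u : R -> R -> R) (s : R -> R),
       unique_similarity_solution a alpha
         (problem_P a k gamma h0 uinf lambda beta delta alpha) xi u s /\
       unique_similarity_solution a alpha
         (problem_PD a k gamma u0 beta delta alpha) xi u s) /\
    unique (coefficient_PD a k gamma u0 beta delta alpha) xi.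
Proof.
  assert (hal : 0 <= alpha) by lra.
  set (kap := k / (2 * a * h0)).
  assert (hkap : 0 < kap) by (apply Rdiv_lt_0_compat; nra).
  set (N := gamma * Rpower 2 (beta + 1) * Rpower a (beta + delta + 2)).
  assert (hN : 0 < N) by (repeat apply Rmult_lt_0_compat; try apply exp_pos; exact hgamma).
  set (p := beta + delta + 1).
  assert (HP : forall z, coefficient_P a k gamma h0 uinf lambda beta delta alpha z <->
    0 < z /\ k * uinf = (kap * even_part alpha z + lambda * odd_part alpha z)
                        * (N * Rpower z p))
    by (intros z; apply coefficient_P_iff; assumption).
  assert (HPD : forall z, coefficient_PD a k gamma u0 beta delta alpha z <->
    0 < z /\ k * u0 = odd_part alpha z * (N * Rpower z p))
    by (intros z; apply coefficient_PD_iff; assumption).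
  assert (UP : forall z z', coefficient_P a k gamma h0 uinf lambda beta delta alpha z ->
    coefficient_P a k gamma h0 uinf lambda beta delta alpha z' -> z = z').
  { intros z z' hz hz'; apply HP in hz; apply HP in hz'.
    destruct hz as [hz E]; destruct hz' as [hz' E'].
    apply (front_map_inj alpha hal kap lambda p); try assumption; try lra.
    apply (Rmult_eq_reg_l N); [unfold front_map; lra | lra]. }
  assert (UPD : forall z z', coefficient_PD a k gamma u0 beta delta alpha z ->
    coefficient_PD a k gamma u0 beta delta alpha z' -> z = z').
  { intros z z' hz hz'; apply HPD in hz; apply HPD in hz'.
    destruct hz as [hz E]; destruct hz' as [hz' E'].
    (* The weights 0 and 1 select the odd part alone. *)
    apply (front_map_inj alpha hal 0 1 p); try assumption; try lra.
    apply (Rmult_eq_reg_l N); [unfold front_map; lra | lra]. }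
  split.
  { destruct (front_map_surj alpha hal kap lambda p hlambda hbd1 (k * uinf / N) hkap)
      as (z & hz & E).
    - apply Rdiv_lt_0_compat; nra.
    - exists z; assert (hz' : coefficient_P a k gamma h0 uinf lambda beta delta alpha z).
      { apply HP; split; [exact hz|].
        replace (k * uinf) with (k * uinf / N * N) by (field; lra).
        rewrite <- E; unfold front_map; ring. }
      split; [exact hz' | intros z'; exact (UP z z' hz')]. }
  intros xi hxiP hu.
  assert (hxi := proj1 hxiP).
  assert (EP := proj2 (proj1 (HP xi) hxiP)).
  assert (hA := even_part_ge_1 alpha hal xi).
  assert (hB := odd_part_pos alpha hal xi hxi).
  set (A := even_part alpha xi) in *; set (B := odd_part alpha xi) in *.
  assert (hD : 0 < kap * A + lambda * B) by nra.
  assert (hu' : u0 * (kap * A + lambda * B) = uinf * B).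
  { rewrite !(Rmult_assoc _ xi), kummer_transformation_odd, kummer_transformation_even in hu.
    fold A B in hu; rewrite hu; assert (hq := exp_pos (- xi ^ 2)).
    field.
    replace (kap * (exp (- xi ^ 2) * A) + lambda * (exp (- xi ^ 2) * B))
      with (exp (- xi ^ 2) * (kap * A + lambda * B)) by ring; nra. }
  assert (EPD : k * u0 = B * (N * Rpower xi p)).
  { apply (Rmult_eq_reg_r (kap * A + lambda * B)); [|lra].
    transitivity (k * uinf * B); [rewrite Rmult_assoc, hu'; ring | rewrite EP; ring]. }
  assert (hxiPD : coefficient_PD a k gamma u0 beta delta alpha xi)
    by (apply HPD; split; assumption).
  split; [|split; [exact hxiPD | intros z; exact (UPD xi z hxiPD)]].
  (* The only second coefficient for which the profile with [c1 = u0] vanishes at [xi]. *)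
  set (c2 := - u0 * A / B).
  assert (Hc2 : forall c, u0 * A + c * B = 0 -> c = c2).
  { intros c E; unfold c2; apply (Rmult_eq_reg_r B); [field_simplify; lra | lra]. }
  set (s := fun t => 2 * xi * a * sqrt t).
  set (u := fun x t => Rpower t (alpha / 2) * comb alpha u0 c2 (x / (2 * a * sqrt t))).
  assert (Hsim : similar a alpha xi u s (comb alpha u0 c2)) by (repeat split; auto).
  assert (hs0 : s 0 = 0) by (unfold s; rewrite sqrt_0; ring).
  assert (Hty : similarity_type a alpha xi u s)
    by exact (similar_similarity_type a alpha _ _ _ _ _ Hsim).
  assert (Ezero : u0 * A + c2 * B = 0) by (unfold c2; field; lra).
  assert (Hsys : common_system a k gamma beta delta u s).
  { apply (similar_common_system a alpha ha _ _ _ _ _ _ _ _ _ hal halpha Hsim).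
    repeat split; assumption. }
  exists u, s; split; (split; [exact Hty | split; [split; [exact Hsys|]|]]).
  - apply (similar_convective a alpha ha _ _ _ _ _ _ _ _ _ hh0 Hsim).
    fold kap; apply (Rmult_eq_reg_r B); [|lra].
    replace (kap * c2 * B) with (kap * (c2 * B)) by ring.
    replace (c2 * B) with (- u0 * A) by lra; lra.
  - intros xi' u' s' Hty' [Hsys' Hconv'].
    destruct (similarity_type_comb a alpha ha _ _ _ Hty' (proj1 Hsys')) as (d1 & d2 & Hsim').
    apply (similar_common_system a alpha ha _ _ _ _ _ _ _ _ _ hal halpha Hsim') in Hsys'.
    destruct Hsys' as (hs0' & Ez' & Es'); fold N p in Es'.
    apply (similar_convective a alpha ha _ _ _ _ _ _ _ _ _ hh0 Hsim') in Hconv'.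
    fold kap in Hconv'.
    assert (hB' := odd_part_pos alpha hal xi' (proj1 Hsim')).
    (* Eliminates [d2] between the zero at the front and the convective condition. *)
    assert (Ed : d1 * (kap * even_part alpha xi' + lambda * odd_part alpha xi')
                 = uinf * odd_part alpha xi').
    { replace uinf with (lambda * d1 - kap * d2) by lra.
      replace (d1 * (kap * even_part alpha xi' + lambda * odd_part alpha xi'))
        with (kap * (d1 * even_part alpha xi') + lambda * d1 * odd_part alpha xi') by ring.
      replace (d1 * even_part alpha xi') with (- (d2 * odd_part alpha xi')) by lra; ring. }
    (* The flux relation, combined with [Ed], is the equation of (P) for [xi'], whose positive
       solution is unique. *)
    assert (Hxi' : xi' = xi).
    { apply UP; [|exact hxiP]; apply HP; split; [exact (proj1 Hsim')|].
      apply (Rmult_eq_reg_r (odd_part alpha xi')); [|lra].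
      rewrite Rmult_assoc, <- Ed.
      replace (k * (d1 * (kap * even_part alpha xi' + lambda * odd_part alpha xi')))
        with (k * d1 * (kap * even_part alpha xi' + lambda * odd_part alpha xi')) by ring.
      rewrite Es'; ring. }
    subst xi'; fold A B in Ed, Ez'.
    (* At [xi], [Ed] for [d1] and [hu'] for [u0] are the same linear equation, with a nonzero
       coefficient. *)
    assert (Hd1 : d1 = u0)
      by (apply (Rmult_eq_reg_r (kap * A + lambda * B)); lra).
    subst d1; apply Hc2 in Ez'; subst d2.
    exact (similar_same_pair a alpha _ _ _ _ _ _ Hsim Hsim' hs0 hs0').
  - apply (similar_dirichlet a alpha ha _ _ _ _ _ _ Hsim); reflexivity.
  - intros xi' u' s' Hty' [Hsys' Hdir'].
    destruct (similarity_type_comb a alpha ha _ _ _ Hty' (proj1 Hsys')) as (d1 & d2 & Hsim').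
    apply (similar_common_system a alpha ha _ _ _ _ _ _ _ _ _ hal halpha Hsim') in Hsys'.
    destruct Hsys' as (hs0' & Ez' & Es'); fold N p in Es'.
    apply (similar_dirichlet a alpha ha _ _ _ _ _ _ Hsim') in Hdir'; subst d1.
    (* With [d1 = u0] the flux relation is already the equation of (P_D) for [xi']. *)
    assert (Hxi' : xi' = xi).
    { apply UPD; [|exact hxiPD]; apply HPD; split; [exact (proj1 Hsim') | exact Es']. }
    subst xi'; fold A B in Ez'; apply Hc2 in Ez'; subst d2.
    exact (similar_same_pair a alpha _ _ _ _ _ _ Hsim Hsim' hs0 hs0').
Qed.
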